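(* For $n\ge0$ let $a_n$ be the number of paths in $\mathcal{M}'_2$ whose end-point lies on the line $y=n-x$ (that is, whose end-point is $(x,n-x)$ for some $x$). Then $$\sum_{n\ge0}a_nz^n=\frac{1}{r-z},\qquad\text{where } r=\frac{z+1+\sqrt{1-2z-3z^{2}}}{2}.$$
   Context: $\mathcal{M}'_2$ is the set of lattice paths in $\mathbb{N}^2$ (with $\mathbb{N}=\{0,1,2,\dots\}$, so paths never go below the $x$-axis) starting at the origin, made of up steps $(1,k)$ with $k\ge 1$, down steps $(1,-1)$ and horizontal steps $(1,0)$, in which every up step and every horizontal step, except possibly when it is the first step of the path, is immediately preceded by a down step. The empty path belongs to $\mathcal{M}'_2$. The square root is the power series with constant term $1$. *)

(* Defs.v *)
From HB Require Import structures.
From mathcomp Require Import all_boot all_order all_algebra finmap.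
From mathcomp Require Import boolp classical_sets functions cardinality.
From mathcomp Require Import ring lra zify.

Set Implicit Arguments.
Unset Strict Implicit.
Unset Printing Implicit Defensive.

Import Order.TTheory GRing.Theory Num.Theory.
Local Open Scope classical_set_scope.
Local Open Scope ring_scope.

(** * Formal power series over a field *)

Record fps (F : fieldType) := Fps { fps_coef :> nat -> F }.

Notation "\fps_ n E" := (Fps (fun n => E))
  (at level 36, E at level 36, n name, format "\fps_ n  E") : ring_scope.

HB.instance Definition _ (F : fieldType) := gen_eqMixin (fps F).
HB.instance Definition _ (F : fieldType) := gen_choiceMixin (fps F).

(* [course g] is the sequence u with u n = g [:: u 0; ...; u (n-1)]. *)
Section CourseOfValues.
Variables (T : Type) (x0 : T) (g : seq T -> T).

Fixpoint course_pref n : seq T :=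
  if n is m.+1 then rcons (course_pref m) (g (course_pref m)) else [::].

Definition course n : T := g (course_pref n).

Lemma course_prefE n : course_pref n = mkseq course n.
Proof. by elim: n => // n IHn; rewrite mkseqS -IHn. Qed.

Lemma courseE n : course n = g (mkseq course n).
Proof. by rewrite {1}/course course_prefE. Qed.

End CourseOfValues.

Section FpsRing.
Variable F : fieldType.
Implicit Types f g h : fps F.

Lemma fpsP f g : (forall n, f n = g n) -> f = g.
Proof. by case: f g => [f] [g] /= fg; congr Fps; apply/funext. Qed.

Definition fps_add f g : fps F := \fps_n (f n + g n).
Definition fps_opp f : fps F := \fps_n (- f n).
Definition fps_mul f g : fps F := \fps_n (\sum_(i < n.+1) f i * g (n - i)%N).
Definition fps_const (c : F) : fps F := \fps_n (if n == 0%N then c else 0).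
Definition fpsX : fps F := \fps_n (n == 1%N)%:R.

Fact fps_addA : associative fps_add.
Proof. by move=> f g h; apply: fpsP => n /=; rewrite addrA. Qed.
Fact fps_addC : commutative fps_add.
Proof. by move=> f g; apply: fpsP => n /=; rewrite addrC. Qed.
Fact fps_add0 : left_id (fps_const 0) fps_add.
Proof. by move=> f; apply: fpsP => n /=; rewrite if_same add0r. Qed.
Fact fps_addN : left_inverse (fps_const 0) fps_opp fps_add.
Proof. by move=> f; apply: fpsP => n /=; rewrite if_same addNr. Qed.

HB.instance Definition _ :=
  GRing.isZmodule.Build (fps F) fps_addA fps_addC fps_add0 fps_addN.

Let trunc n f : {poly F} := \poly_(i < n.+1) f i.

Let truncE n f i : (i <= n)%N -> (trunc n f)`_i = f i.
Proof. by move=> le_in; rewrite coef_poly ltnS le_in. Qed.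

Let mul_trunc n f g i : (i <= n)%N ->
  fps_mul f g i = (trunc n f * trunc n g)`_i.
Proof.
move=> le_in; rewrite coefM /=; apply: eq_bigr => j _.
by rewrite !truncE ?(leq_trans (leq_subr _ _)) ?(leq_trans (leq_ord j)).
Qed.

Fact fps_mulC : commutative fps_mul.
Proof. by move=> f g; apply: fpsP => n; rewrite !(@mul_trunc n) // mulrC. Qed.

Fact fps_mulA : associative fps_mul.
Proof.
move=> f g h; apply: fpsP => n.
transitivity ((trunc n f * (trunc n g * trunc n h))`_n).
  rewrite coefM /=; apply: eq_bigr => j _.
  by rewrite truncE ?leq_ord // -mul_trunc ?leq_subr.
rewrite mulrA coefM /=; apply: eq_bigr => j _.
by rewrite truncE ?leq_subr // -mul_trunc ?leq_ord.
Qed.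

Fact fps_mul1 : left_id (fps_const 1) fps_mul.
Proof.
move=> f; apply: fpsP => n /=; rewrite big_ord_recl /= mul1r subn0.
by rewrite big1 ?addr0 // => i _; rewrite mul0r.
Qed.

Fact fps_mulDl : left_distributive fps_mul fps_add.
Proof.
move=> f g h; apply: fpsP => n /=; rewrite -big_split /=.
by apply: eq_bigr => i _; rewrite mulrDl.
Qed.

Fact fps_1neq0 : fps_const 1 != fps_const 0.
Proof.
by apply/eqP => /(congr1 (fun f : fps F => f 0%N)) /eqP; rewrite /= oner_eq0.
Qed.

HB.instance Definition _ := GRing.Zmodule_isComNzRing.Build (fps F)
  fps_mulA fps_mulC fps_mul1 fps_mulDl fps_1neq0.

Lemma fps_coef0 n : (0 : fps F) n = 0.
Proof. by rewrite [LHS]if_same. Qed.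
Lemma fps_coef1 n : (1 : fps F) n = (n == 0%N)%:R.
Proof. by rewrite [LHS]/=; case: eqP. Qed.
Lemma fps_coefD f g n : (f + g) n = f n + g n. Proof. by []. Qed.
Lemma fps_coefN f n : (- f) n = - f n. Proof. by []. Qed.
Lemma fps_coefM f g n : (f * g) n = \sum_(i < n.+1) f i * g (n - i)%N.
Proof. by []. Qed.

Definition fps_unit : {pred fps F} := fun f => f 0%N != 0.

Definition fps_inv_coef f : nat -> F :=
  course (fun b => if b is [::] then (f 0%N)^-1 else
    - (f 0%N)^-1 * \sum_(1 <= i < (size b).+1) f i * b`_(size b - i)).

Definition fps_inv f : fps F :=
  if f \in fps_unit then Fps (fps_inv_coef f) else f.

Fact fps_mulVf : {in fps_unit, left_inverse 1 fps_inv *%R}.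
Proof.
move=> f uf; rewrite /fps_inv uf mulrC; apply: fpsP => n.
have f0 : f 0%N != 0 by [].
rewrite fps_coefM fps_coef1 big_ord_recl /= subn0.
case: n => [|n] /=; first by rewrite big_ord0 addr0 divff.
rewrite {1}/fps_inv_coef courseE mkseqS /=.
case E: (rcons _ _) => [|b s]; first by case: (mkseq _ _) E.
rewrite -E size_rcons size_mkseq -mkseqS mulNr mulrN mulrA divff // mul1r.
rewrite big_add1 big_mkord; apply/eqP; rewrite addrC subr_eq0; apply/eqP.
apply: eq_bigr => i _; rewrite nth_mkseq // subSS; exact: leq_ltn_trans (leq_subr _ _) _.
Qed.

Fact fps_unitPl f g : g * f = 1 -> fps_unit f.
Proof.
move=> /(congr1 (fun h : fps F => h 0%N)); rewrite fps_coefM big_ord1 fps_coef1.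
move=> /= gf1; apply/eqP => f0; move/eqP: gf1.
by rewrite f0 mulr0 eq_sym oner_eq0.
Qed.

Fact fps_inv_out : {in [predC fps_unit], fps_inv =1 id}.
Proof. by move=> f; rewrite inE /= /fps_inv => /negbTE ->. Qed.

HB.instance Definition _ := GRing.ComNzRing_hasMulInverse.Build (fps F)
  fps_mulVf fps_unitPl fps_inv_out.

Lemma fps_unitE f : (f \is a GRing.unit) = (f 0%N != 0).
Proof. by []. Qed.

(* The square root with constant term 1 of a series f with constant term 1,
   obtained by solving s ^+ 2 = f coefficient by coefficient; see
   [fps_sqrtP] and [fps_sqrt_unique]. *)
Definition fps_sqrt f : fps F :=
  Fps (course (fun s => if s is [::] then 1 else
    (f (size s) - \sum_(1 <= i < size s) s`_i * s`_(size s - i)) / 2)).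

Lemma fps_sqrt0 f : fps_sqrt f 0%N = 1. Proof. by []. Qed.

Lemma fps_sqrtP f : (2 : F) != 0 -> f 0%N = 1 -> fps_sqrt f ^+ 2 = f.
Proof.
move=> n2 f0; apply: fpsP => n; rewrite expr2 fps_coefM.
case: n => [|n]; first by rewrite big_ord1 f0 mulr1.
rewrite big_ord_recl big_ord_recr /= subn0 subnn /=.
set u := course _; have u0 : u 0%N = 1 by [].
have -> : u n.+1 = (f n.+1 - \sum_(1 <= i < n.+1) u i * u (n.+1 - i)%N) / 2.
  rewrite {1}/u courseE -/u mkseqS.
  case E: (rcons _ _) => [|b s]; first by case: (mkseq _ _) E.
  rewrite -E size_rcons size_mkseq -mkseqS; congr ((_ - _) / _).
  by apply: eq_big_nat => i /andP[i0 lin]; rewrite !nth_mkseq //; lia.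
rewrite u0 big_add1 big_mkord /bump /=; field.
by [].
Qed.

Lemma fps_sqrt_unique f (s : fps F) : (2 : F) != 0 ->
  s 0%N = 1 -> s ^+ 2 = f -> s = fps_sqrt f.
Proof.
move=> n2 s0 sf; have f0 : f 0%N = 1.
  by rewrite -sf expr2 fps_coefM big_ord1 s0 mulr1.
have: s ^+ 2 = fps_sqrt f ^+ 2 by rewrite fps_sqrtP.
move/eqP; rewrite -subr_eq0 subr_sqr => /eqP.
have us : s + fps_sqrt f \is a GRing.unit.
  by rewrite fps_unitE fps_coefD s0 fps_sqrt0.
move=> sub0; apply/eqP; rewrite -subr_eq0; apply/eqP; apply: (mulIr us).
by rewrite mul0r.
Qed.

End FpsRing.

Arguments fpsX {F}.

(** * Lattice paths *)

(* A path starting at the origin is the sequence of its step vectors. *)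
Definition step : Type := (int * int)%type.

Definition up_step (s : step) : bool := (s.1 == 1) && (1 <= s.2).
Definition down_step (s : step) : bool := s == (1, -1).
Definition horiz_step (s : step) : bool := s == (1, 0).

Definition endpoint (p : seq step) : int * int := \sum_(s <- p) s.

(* [sorted e p] compares every step of p with its immediate predecessor. *)
Definition M2' : set (seq step) := [set p |
  [/\ all (fun s => [|| up_step s, down_step s | horiz_step s]) p,
      forall k, 0 <= (endpoint (take k p)).1 /\ 0 <= (endpoint (take k p)).2
    & sorted (fun s t => (up_step t || horiz_step t) ==> down_step s) p]].

Definition M2'_line (n : nat) : set (seq step) :=
  [set p | M2' p /\ (endpoint p).2 = n%:Z - (endpoint p).1].

Lemma finite_M2'_line n : finite_set (M2'_line n).
Proof.
pose f (q : n.-bseq 'I_n.+1) : seq step :=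
  [seq (1, (nat_of_ord i)%:Z - 1) | i <- bseqval q].
apply: (@sub_finite_set _ _ (range f)); last first.
  by apply: finite_image; exact: finite_finset.
move=> p [[ok_p nonneg _] line_p].
have e1 q : (endpoint q).1 = \sum_(s <- q) s.1 by apply: big_morph.
have e2 q : (endpoint q).2 = \sum_(s <- q) s.2 by apply: big_morph.
have sz_p : (endpoint p).1 = (size p)%:Z.
  rewrite e1; elim: p ok_p {nonneg line_p} => [|s p IHp] /=.
    by rewrite big_nil.
  case/andP=> ok_s /IHp IH; rewrite big_cons IH.
  have -> : s.1 = 1 by case/or3P: ok_s => [/andP[/eqP]|/eqP->|/eqP->].
  by lia.
have le_sz : (size p <= n)%N.
  have [_] := nonneg (size p); rewrite take_size line_p sz_p; lia.
have sum_p : \sum_(s <- p) (s.1 + s.2) = n%:Z.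
  by rewrite big_split /= -e1 -e2 line_p; lia.
have ge0 s : s \in p -> 0 <= s.1 + s.2.
  move/(allP ok_p) => /or3P[/andP[/eqP-> ?]|/eqP->|/eqP->] //=; lia.
have le_n s : s \in p -> s.1 + s.2 <= n%:Z.
  move=> sp; rewrite -sum_p (big_rem s) //= lerDl big_seq sumr_ge0 //.
  by move=> t /mem_rem /ge0.
pose q : seq 'I_n.+1 := [seq inord (absz (s.1 + s.2)) | s <- p].
have le_q : (size q <= n)%N by rewrite size_map.
exists (Bseq le_q) => //; rewrite /f /= /q -map_comp.
rewrite -[RHS]map_id; apply/eq_in_map => s sp /=.
have s1 : s.1 = 1.
  by case/or3P: (allP ok_p s sp) => [/andP[/eqP]|/eqP->|/eqP->].
have := ge0 s sp; have := le_n s sp.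
case: s {sp} s1 => x y /= -> le ge.
by rewrite inordK; [congr pair; lia | lia].
Qed.

(* By [finite_M2'_line] this is the genuine cardinal ([fset_set] would be empty
   on an infinite set). *)
Definition num_M2'_line (n : nat) : nat := #|` fset_set (M2'_line n)|.

(* Main.v *)
Require Import Defs.
From mathcomp Require Import all_boot all_order all_algebra.
From mathcomp Require Import finmap classical_sets cardinality.
From mathcomp Require Import ring zify.

(** Let M = 1 / (r - z).  Removing the square root from the definition of r
    turns the claim into the statement that the counting series is the power
    series M with M = 1 + z M + z^2 M^2 ([quadratic_eq]): the numbers a_n are
    the Motzkin numbers.

    To count paths, their suffixes are counted too.  A suffix is started at a
    height h, and its weight is the sum of the two coordinates of its
    displacement; a path ends on y = n - x iff its weight is n.  Besides h, all
    that a suffix has to know about the past is whether the previous step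
    leaves the next one free (it was a down step, or there was none) or forces
    it to be a down step.  Let P_h and N_h be the series, by weight, of the free
    and of the forced suffixes.  Down steps have weight 0 and a step that rises
    by k >= 0 has weight k + 1, so removing the first step gives
      N_h = 1 + P_(h-1), with P_(-1) = 0,
      P_h = N_h + z (N_h + z N_(h+1) + z^2 N_(h+2) + ...).
    Subtracting z times the second equation at h + 1 from the one at h leaves
    the linear recurrence z P_(h+1) = (1 + z) P_h - (1 + z) P_(h-1) - 1.  Its
    particular solution is the constant -1/z, and its characteristic equation
    z x^2 - (1 + z) x + (1 + z) = 0 has the power series root x = 1 + z M, so
    that the expected solution is
      P_h = (x^(h+1) - 1) / z = M (1 + x + ... + x^h) = [geom M h.+1].
    The system determines all coefficients, since a step lowers height plus
    remaining weight by exactly one; [size_paths] is the induction on that sum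
    which shows that the guessed solution is the right one.  At h = 0 it reads
    P_0 = M. *)

Set Implicit Arguments.
Unset Strict Implicit.
Unset Printing Implicit Defensive.

Import Order.TTheory GRing.Theory Num.Theory.
Local Open Scope ring_scope.

(** * Suffixes of paths *)

Lemma endpoint_nil : endpoint [::] = 0.
Proof. by rewrite /endpoint big_nil. Qed.

Lemma endpoint_cons s p : endpoint (s :: p) = s + endpoint p.
Proof. by rewrite /endpoint big_cons. Qed.

(** [b] tells whether the first step is free; when it is not, that step has to
    be a down step. *)
Fixpoint valid (b : bool) (h : int) (p : seq step) : bool :=
  (0 <= h) &&
  if p is s :: q then
    [&& s.1 == 1, (s.2 == -1) || (b && (0 <= s.2))
      & valid (s.2 == -1) (h + s.2) q]
  else true.

Lemma down_stepE (s : step) : s.1 = 1 -> down_step s = (s.2 == -1).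
Proof. by case: s => x y /= ->; rewrite /down_step xpair_eqE eqxx. Qed.

(** The step [s] stands for the one that precedes the suffix [p]. *)
Lemma validP (s : step) (h : int) p :
  valid (down_step s) h p <->
  [/\ all (fun s => [|| up_step s, down_step s | horiz_step s]) p,
      forall k, 0 <= h + (endpoint (take k p)).2
    & path (fun s t => (up_step t || horiz_step t) ==> down_step s) s p].
Proof.
elim: p s h => [|t q IHq] s h.
  rewrite /= andbT; split=> [h0|[_ /(_ 0%N)]]; last first.
    by rewrite endpoint_nil addr0.
  by split=> // k; rewrite endpoint_nil addr0.
have okE : [|| up_step t, down_step t | horiz_step t] =
    (t.1 == 1) && ((t.2 == -1) || (0 <= t.2)).
  rewrite /up_step /down_step /horiz_step; case: t {IHq} => x y /=.
  by rewrite !xpair_eqE; lia.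
have upE : up_step t || horiz_step t = (t.1 == 1) && (0 <= t.2).
  rewrite /up_step /horiz_step; case: t {IHq okE} => x y /=.
  by rewrite !xpair_eqE; lia.
rewrite /= okE upE; split.
  case/and4P=> h0 t1; rewrite -(down_stepE (eqP t1)) => t2 /IHq.
  case=> ok_q nonneg path_q; split.
  - rewrite t1 ok_q andbT; move: t2.
    by case: (down_step t) => //= /andP[_ ->].
  - case=> [|k]; first by rewrite endpoint_nil addr0.
    by rewrite endpoint_cons /= addrA.
  - rewrite t1 path_q andbT; move: t2.
    case: (down_step s); first by rewrite implybT.
    rewrite orbF /down_step => /eqP->; exact: isT.
case=> /andP[/andP[t1 t2] ok_q] nonneg /andP[].
rewrite t1 -(down_stepE (eqP t1)) in t2 * => flag path_q.
apply/and4P; split=> //.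
- by have := nonneg 0%N; rewrite endpoint_nil addr0.
- by case: (down_step t) t2 flag => //= ->; rewrite /= andbT.
- apply/IHq; split=> // k; have := nonneg k.+1.
  by rewrite /= endpoint_cons /= addrA.
Qed.

Lemma valid_endpoint b h p : valid b h p ->
  (endpoint p).1 = (size p)%:Z /\ 0 <= h + (endpoint p).2.
Proof.
elim: p b h => [|s q IHq] b h /=; first by rewrite andbT endpoint_nil addr0.
case/and4P=> _ /eqP s1 _ /IHq[].
rewrite endpoint_cons /= s1 addrA => -> ?.
by split=> //; rewrite intS.
Qed.

Lemma valid_weight_ge0 b h p : valid b h p ->
  0 <= (endpoint p).1 + (endpoint p).2.
Proof.
elim: p b h => [|s q IHq] b h /=; first by rewrite endpoint_nil.
by case/and4P=> _ /eqP s1 s2 /IHq; rewrite endpoint_cons /= s1; lia.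
Qed.

(** The first step of a path is unconstrained, just as if it were preceded by a
    down step. *)
Lemma M2'_valid p : M2' p <-> valid true 0 p.
Proof.
pose e (s t : step) := (up_step t || horiz_step t) ==> down_step s.
have sorted_path : sorted e p = path e (1, -1) p.
  by case: p => //= t q; rewrite /e implybT.
rewrite /M2' /= -/e sorted_path; split=> [[ok nonneg sort]|].
  apply/(validP (1, -1)); split=> // k; rewrite add0r.
  by case: (nonneg k).
case/(validP (1, -1)) => ok nonneg sort; split=> // k.
move: (nonneg k); rewrite add0r => ->; split=> //.
have : all (fun s => [|| up_step s, down_step s | horiz_step s]) (take k p).
  by move: ok; rewrite -{1}(cat_take_drop k p) all_cat => /andP[].
elim: (take k p) => [|s q IHq] /=; first by rewrite endpoint_nil.
case/andP=> ok_s /IHq; rewrite endpoint_cons /=.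
by case/or3P: ok_s => [/andP[/eqP-> _]|/eqP->|/eqP->] /=; lia.
Qed.

(** * Enumeration of the suffixes *)

(** Here [L] is height plus weight: every step lowers the sum of the current
    height and the remaining weight by one, which makes the recursion
    structural.  A suffix may be empty when no weight remains, i.e. [h = L]. *)
Fixpoint paths (L : nat) (b : bool) (h : nat) : seq (seq step) :=
  nseq (h == L) [::] ++
  if L is L'.+1 then
    (if h is h'.+1 then [seq ((1, -1) : step) :: q | q <- paths L' true h']
     else [::]) ++
    (if b then
       [seq ((1, k%:Z) : step) :: q
         | k <- iota 0 (L - h), q <- paths L' false (h + k)%N]
     else [::])
  else [::].

(** The bound on the rise [k] in [paths] loses nothing because the remaining
    weight of a valid suffix is never negative ([valid_weight_ge0]). *)
Lemma mem_paths L b h p :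
  (p \in paths L b h) =
  valid b h p && (h%:Z + (endpoint p).1 + (endpoint p).2 == L%:Z).
Proof.
elim: L b h p => [|L IHL] b h [|s q].
- by rewrite /= cats0 mem_nseq endpoint_nil !addr0 eqxx andbT; case: eqP; lia.
- rewrite /paths cats0 mem_nseq andbF; apply/esym/negP => /andP[].
  by case/valid_endpoint=> + h0; rewrite [size _]/= => ->; lia.
- rewrite /= !mem_cat mem_nseq endpoint_nil !addr0 eqxx andbT.
  have -> : ([::] \in (if h is h'.+1 then
      [seq ((1, -1) : step) :: q | q <- paths L true h'] else [::])) = false.
    by case: h => [|h] //; apply/negP => /mapP[].
  rewrite -/step; case: b; last by rewrite !orbF; lia.
  rewrite [X in _ || (_ || X)](_ : _ = false); first by rewrite !orbF; lia.
  by apply/negP => /allpairsPdep[k [q []]].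
rewrite [paths _ _ _]/= !mem_cat mem_nseq andbF orFb [valid _ _ _]/=.
rewrite endpoint_cons.
set upper := (X in _ || X).
have upperE : upper = [&& b, s.1 == 1, 0 <= s.2 &
    valid false (h%:Z + s.2) q &&
    (h%:Z + s.2 + (endpoint q).1 + (endpoint q).2 == L%:Z)].
  rewrite /upper; case: b {upper} => //=; apply/allpairsPdep/and3P.
    case=> k [q' [_ + [-> ->]]]; rewrite IHL PoszD => qP.
    by split.
  case: s => x [k|k] [] //= /eqP-> _ qP; exists k, q; split=> //.
    move: qP => /andP[/valid_weight_ge0]; rewrite mem_iota; lia.
  by rewrite IHL PoszD.
have lowerE : (s :: q \in (if h is h'.+1 then
      [seq ((1, -1) : step) :: q | q <- paths L true h'] else [::])) =
    [&& s.1 == 1, s.2 == -1 &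
    valid true (h%:Z + s.2) q &&
    (h%:Z + s.2 + (endpoint q).1 + (endpoint q).2 == L%:Z)].
  case: h {upper upperE} => [|h].
    apply/esym/negP => /and4P[_ /eqP->]; case: q => [|? ?] //=.
  have hE : h.+1%:Z + -1 = h by lia.
  apply/mapP/and3P => [[q' + [-> ->]]|]; first by rewrite IHL hE.
  by case: s => x y [/= /eqP-> /eqP->]; rewrite hE -IHL; exists q.
rewrite upperE lowerE {upper upperE lowerE} /=.
case: eqP => [->|_] /=; last by rewrite !andbF.
case: eqP => [->|s2] /=.
  by rewrite andbF orbF; congr (_ && _); lia.
by rewrite -!andbA; do 3!congr (_ && _); lia.
Qed.

Lemma paths_uniq L b h : uniq (paths L b h).
Proof.
elim: L b h => [|L IHL] b h; first by rewrite /= cats0; case: (h == 0)%N.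
rewrite /= !cat_uniq; apply/and3P; split; first by case: (h == L.+1).
  apply/hasPn => p; apply: contraL; rewrite mem_nseq => /andP[_ /eqP->].
  rewrite mem_cat negb_or; apply/andP; split.
    by case: h => [|h] //; apply/negP => /mapP[].
  by case: b => //; apply/negP => /allpairsPdep[k [q []]].
apply/and3P; split.
- case: h => [|h] //; by rewrite map_inj_uniq // => p q [].
- apply/hasPn => p; case: b => // /allpairsPdep[k [q [_ _ ->]]].
  by case: h => [|h] //; apply/negP => /mapP[q' _ []].
- case: b => //; apply: allpairs_uniq_dep => //; first exact: iota_uniq.
  move=> _ _ /allpairsPdep[k [q [_ _ ->]]] /allpairsPdep[k' [q' [_ _ ->]]].
  by case=> -> ->.
Qed.

Lemma num_M2'_lineE n : num_M2'_line n = size (paths n true 0).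
Proof.
rewrite /num_M2'_line -(undup_id (paths_uniq n true 0)) -card_fseq.
congr #|` _|; apply/fsetP => p; rewrite inE /= in_fset_set; last first.
  exact: finite_M2'_line.
rewrite mem_paths add0r.
apply/idP/andP.
  rewrite inE => -[/M2'_valid -> ->]; split=> //; lia.
case=> /M2'_valid pM /eqP pn; rewrite inE; split=> //; lia.
Qed.

Lemma size_paths_true L h :
  size (paths L true h) =
  (size (paths L false h) + \sum_(k < L - h) size (paths L.-1 false (h + k)))%N.
Proof.
case: L => [|L]; first by rewrite big_ord0 addn0.
rewrite [paths _ true _]/= [paths _ false _]/= cats0 !size_cat addnA.
congr addn.
rewrite size_allpairs_dep sumnE big_map.
rewrite -(big_mkord xpredT (fun k => size (paths L false (h + k)))).
by rewrite /index_iota subn0.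
Qed.

Lemma size_paths_false L h :
  size (paths L false h) =
  ((h == L) +
   if (h, L) is (h'.+1, L'.+1) then size (paths L' true h') else 0)%N.
Proof.
case: L => [|L]; first by rewrite /= cats0 size_nseq; case: h.
rewrite [paths _ _ _]/= cats0 size_cat size_nseq; congr addn.
by case: h => // h; rewrite size_map.
Qed.

(** * The series of the suffixes *)

Section Series.
Variable F : fieldType.
Implicit Types f M : fps F.

Lemma fps_coef0_mulX f : (fpsX * f) 0%N = 0.
Proof. by rewrite fps_coefM big_ord1 mul0r. Qed.

Lemma fps_coefS_mulX f n : (fpsX * f) n.+1 = f n.
Proof.
rewrite fps_coefM !big_ord_recl /= mul0r mul1r add0r subSS subn0.
by rewrite big1 ?addr0 // => i _; rewrite mul0r.
Qed.

(** This is (x^h - 1) / z for x = 1 + z M, written without a division by the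
    non-unit z; see [mulX_geom]. *)
Definition geom M h : fps F := M * \sum_(i < h) (1 + fpsX * M) ^+ i.

Lemma geomS M h : geom M h.+1 = geom M h + M * (1 + fpsX * M) ^+ h.
Proof. by rewrite /geom big_ord_recr mulrDr. Qed.

Lemma mulX_geom M h : fpsX * geom M h = (1 + fpsX * M) ^+ h - 1.
Proof. by rewrite subrX1 addrAC subrr add0r mulrA. Qed.

Variable M : fps F.
Hypothesis ME : M = 1 + fpsX * M + fpsX ^+ 2 * M ^+ 2.

(** In the notation of the introduction, [1 + geom M h] is N_h, so the
    difference on the left is P_h - N_h = M x^h - 1.  It has to be
    z (N_h + z N_(h+1) + ...), a sum T_h with T_h = z (N_h + T_(h+1)); the
    closed form satisfies this relation because M = 1 + z M x. *)
Lemma geom_diff h :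
  geom M h.+1 - geom M h - 1 =
  fpsX * ((1 + geom M h) + (geom M h.+2 - geom M h.+1 - 1)).
Proof.
rewrite !geomS.
set x := 1 + fpsX * M; set g := geom M h.
have gE : fpsX * g = x ^+ h - 1 by exact: mulX_geom.
have MxE : M = 1 + fpsX * M * x by rewrite {1}ME /x; ring.
rewrite exprS.
transitivity (M * x ^+ h - 1); first by ring.
rewrite {1}MxE.
transitivity (fpsX * g + fpsX * M * (x * x ^+ h)); last by ring.
rewrite gE; ring.
Qed.

Lemma geom_diff_coefE h n :
  (geom M h.+1 - geom M h - 1) n =
  \sum_(k < n) (1 + geom M (h + k)) (n.-1 - k)%N.
Proof.
elim: n h => [|n IHn] h; first by rewrite geom_diff fps_coef0_mulX big_ord0.
rewrite geom_diff fps_coefS_mulX fps_coefD IHn big_ord_recl addn0 subn0.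
congr (_ + _); apply: eq_bigr => k _.
by rewrite lift0 addSnnS -subn1 -subnDA add1n.
Qed.

(** Induction on [h + n]: the closed forms satisfy the same two recurrences as
    the cardinals.  The forced case comes first because the free case at the
    same [h] and [n] uses it. *)
Lemma size_paths h n :
  (size (paths (h + n) true h))%:R = (geom M h.+1) n /\
  (size (paths (h + n) false h))%:R = (1 + geom M h) n.
Proof.
move: {2}(h + n)%N (erefl (h + n)%N) => L; elim/ltn_ind: L h n => L IHL h n LE.
have falseE : (size (paths (h + n) false h))%:R = (1 + geom M h) n.
  rewrite size_paths_false natrD fps_coefD fps_coef1 -{1}[h]addn0 eqn_add2l.
  rewrite eq_sym; congr (_ + _); case: h LE => [|h] LE.
    by rewrite /geom big_ord0 mulr0 fps_coef0.
  by have [] := IHL (h + n)%N _ h n erefl; first by lia.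
split=> //; rewrite size_paths_true natrD falseE.
have -> : geom M h.+1 = (1 + geom M h) + (geom M h.+1 - geom M h - 1) by ring.
rewrite [RHS]fps_coefD geom_diff_coefE natr_sum addKn; congr (_ + _).
apply: eq_bigr => k _; have kn := ltn_ord k.
have kn1 : (h + n = (h + n).-1.+1)%N by lia.
have hk : (h + k + (n.-1 - k) = (h + n).-1)%N by lia.
have [|_ <-] := IHL (h + n).-1 _ (h + k)%N (n.-1 - k)%N hk.
  by rewrite -LE; lia.
by rewrite hk.
Qed.

End Series.

(** * The algebraic equation *)

(** Put q = r - z.  Then 2 q + z - 1 is the square root of 1 - 2 z - 3 z^2, and
    squaring gives q = q^2 + z q + z^2; multiply by M^2 = q^-2. *)
Lemma quadratic_eq (F : fieldType) (z := fpsX : fps F)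
    (r := (z + 1 + fps_sqrt (1 - 2 * z - 3 * z ^+ 2)) / 2) (M := 1 / (r - z)) :
  (2 : F) != 0 -> M = 1 + z * M + z ^+ 2 * M ^+ 2.
Proof.
move=> nz2.
have two0 : (2 : fps F) 0%N = 2 by rewrite fps_coefD fps_coef1.
have unit2 : (2 : fps F) \is a GRing.unit by rewrite fps_unitE two0.
have z0 (f : fps F) : (z * f) 0%N = 0 by exact: fps_coef0_mulX.
have sE : fps_sqrt (1 - 2 * z - 3 * z ^+ 2) ^+ 2 = 1 - 2 * z - 3 * z ^+ 2.
  apply: fps_sqrtP => //.
  have -> : 1 - 2 * z - 3 * z ^+ 2 = 1 - z * (2 + 3 * z) by ring.
  by rewrite fps_coefD fps_coefN z0 subr0 fps_coef1.
have s0 := fps_sqrt0 (1 - 2 * z - 3 * z ^+ 2).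
rewrite {}/M {}/r; move: (fps_sqrt _) sE s0 => s sE s0.
set q := _ - z; set M := 1 / q.
have sqE : 2 * q = 1 - z + s.
  by rewrite /q mulrBr mulrC divrK //; ring.
have q_unit : q \is a GRing.unit.
  rewrite -(unitrMr q unit2) sqE fps_unitE -[z]mulr1.
  by rewrite !fps_coefD fps_coefN z0 fps_coef1 subr0 s0.
have Mq : M * q = 1 by rewrite /M divrK.
have qE : q = q ^+ 2 + z * q + z ^+ 2.
  have unit4 : (4 : fps F) \is a GRing.unit.
    by rewrite (_ : 4 = 2 * 2) ?unitrM ?unit2 //; ring.
  apply: (mulrI unit4).
  have sE' : s = 2 * q - 1 + z by rewrite sqE; ring.
  move: sE; rewrite sE' => sE.
  apply/eqP; rewrite -subr_eq0; apply/eqP.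
  transitivity (1 - 2 * z - 3 * z ^+ 2 - (2 * q - 1 + z) ^+ 2); first by ring.
  by rewrite sE subrr.
transitivity (M ^+ 2 * q); first by rewrite expr2 -mulrA Mq mulr1.
rewrite {1}qE.
transitivity ((M * q) ^+ 2 + z * M * (M * q) + z ^+ 2 * M ^+ 2); first by ring.
by rewrite Mq expr1n mulr1.
Qed.

Theorem corollary6 :
  let z : fps rat := fpsX in
  let r := (z + 1 + fps_sqrt (1 - 2 * z - 3 * z ^+ 2)) / 2 in
  \fps_n ((num_M2'_line n)%:R : rat) = 1 / (r - z).
Proof.
move=> z r; apply: fpsP => n.
have [size_n _] := size_paths (quadratic_eq (isT : (2 : rat) != 0)) 0 n.
rewrite [LHS]/= num_M2'_lineE -[n in paths n]add0n size_n geomS.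
by rewrite /geom big_ord0 mulr0 add0r expr0 mulr1.
Qed.
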